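(* Let $K\ge2$ be an integer and let $n\ge n_0(K)$. Then the number $N^{\sim_2}_K(n)$ of $\sim_2$-classes in $\{\mathtt a,\mathtt b\}^n$ of cardinality $K$ is $$N^{\sim_2}_K(n)=2\varepsilon_K\,(n-2\rho_K+1)+4\sum_{r=2}^{\rho_K-1}c_K(r).$$
   Context: For $u,w\in\{\mathtt a,\mathtt b\}^n$, $u\sim_2w$ iff $u$ and $w$ have the same number of letters $\mathtt a$ and $\binom{u}{\mathtt{ab}}=\binom{w}{\mathtt{ab}}$, where $\binom{w}{\mathtt{ab}}$ is the number of occurrences of $\mathtt{ab}$ as a scattered subword of $w$. Let $p(\xi)$ be the number of partitions of the integer $\xi\ge0$ and $p_{\le r}(\xi)$ the number of partitions of $\xi$ with at most $r$ parts. Set $\rho_K=\min\{\xi\ge0:p(\xi)>K\}$; $\varepsilon_K=1$ if $K$ is a value of $p$ and $\varepsilon_K=0$ otherwise. For $2\le r<\rho_K$ set $c_K(r)=\#\{\xi\ge0:p_{\le r}(\xi)=K\}$ and $\tau_K(r)=\max\{\xi\ge0:p_{\le r}(\xi)=K\}$, with $\tau_K(r)=-\infty$ when no such $\xi$ exists. Finally $$n_0(K)=\max\Bigl(2\rho_K-1,\ \max_{2\le r<\rho_K}\bigl(r+\tau_K(r)+1\bigr)\Bigr).$$ *)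

(* Defs.v *)
From mathcomp Require Import all_boot.
From mathcomp Require Import finmap boolp classical_sets cardinality.

Set Implicit Arguments.
Unset Strict Implicit.
Unset Printing Implicit Defensive.

Definition letter_a : bool := false.
Definition letter_b : bool := true.

(* Binomial coefficient of words: each mask [m] is a choice of positions in   *)
(* [w], and [mask m w] is the word read at these positions.                   *)
Definition word_bin (n : nat) (w : n.-tuple bool) (v : seq bool) : nat :=
  #|[pred m : n.-tuple bool | mask m w == v]|.

Definition sim2 (n : nat) : rel (n.-tuple bool) :=
  fun u w => (count_mem letter_a u == count_mem letter_a w) &&
    (word_bin u [:: letter_a; letter_b] == word_bin w [:: letter_a; letter_b]).

Definition num_classes (K n : nat) : nat :=
  #|[pred C in equivalence_partition (@sim2 n) [set: n.-tuple bool]%SET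
      | #|C| == K]|.

Definition is_partition (xi : nat) (s : seq nat) : bool :=
  [&& sorted geq s, 0 \notin s & sumn s == xi].

(* A partition of [xi] has at most [xi] parts, all at most [xi], so that      *)
(* counting sequences in [xi.-bseq 'I_xi.+1] misses none: see                 *)
(* [is_partition_bseq].                                                       *)
Definition num_part (xi : nat) : nat :=
  #|[pred s : xi.-bseq 'I_xi.+1 | is_partition xi (map val s)]|.

Definition num_part_le (r xi : nat) : nat :=
  #|[pred s : xi.-bseq 'I_xi.+1 |
      is_partition xi (map val s) && (size s <= r)]|.

Lemma is_partition_bseq (xi : nat) (s : seq nat) :
  is_partition xi s -> exists t : xi.-bseq 'I_xi.+1, map val t = s.
Proof.
case/and3P=> _ s0 /eqP sums.
have les x : x \in s -> x <= xi.
  by move=> /perm_to_rem/perm_sumn; rewrite sums /= => ->; apply: leq_addr.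
have szs : size (map (@inord xi) s) <= xi.
  rewrite size_map -sums; elim: s s0 {sums les} => //= x s IHs.
  rewrite inE negb_or eq_sym -lt0n => /andP[x0 /IHs].
  by rewrite -add1n; apply: leq_add.
exists (Bseq szs) => /=; rewrite -map_comp -[RHS]map_id.
by apply/eq_in_map => x /les lex /=; rewrite inordK.
Qed.

Lemma num_part_le_half (r xi : nat) : 1 < r -> xi./2 < num_part_le r xi.
Proof.
move=> r1; pose g k := [seq x <- [:: xi - k; k] | x != 0].
pose f k : xi.-bseq 'I_xi.+1 := insub_bseq xi (map inord (g k)).
have k2 k : k < xi./2.+1 -> k <= xi - k.
  rewrite ltnS => kx; rewrite leq_subRL ?addnn -?geq_half_double //.
  apply: leq_trans kx _; rewrite -{2}(half_bit_double xi false) /= add0n.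
  by rewrite half_leq // -addnn leq_addr.
have gP k : k < xi./2.+1 -> is_partition xi (g k).
  move=> /k2 kx; have kxi : k <= xi by apply: leq_trans kx (leq_subr _ _).
  apply/and3P; split.
  - by apply: sorted_filter => /=; [exact: rev_trans leq_trans | rewrite andbT].
  - by rewrite mem_filter eqxx.
  - apply/eqP; rewrite -[RHS](subnK kxi) /g /=.
    by case: (xi - k) kx => [|m] /=; case: (k) => //= *; rewrite ?addn0.
have fP k : k < xi./2.+1 -> map val (f k) = g k.
  move=> /gP /is_partition_bseq[t tg]; rewrite /f -tg -map_comp.
  rewrite (@eq_map _ _ _ id) ?map_id; last by move=> i /=; rewrite inord_val.
  by rewrite /insub_bseq /insubd valK.
have gI k : k < xi./2.+1 -> nth 0 (g k) 1 = k.
  by move=> /k2; rewrite /g /=; case: (xi - k) => [|m]; case: (k).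
pose h (k : 'I_xi./2.+1) := f k.
have hI : injective h.
  move=> i j /(congr1 (fun t : xi.-bseq _ => map val t)).
  rewrite /h !fP // => /(congr1 (fun s => nth 0 s 1)).
  by rewrite !gI // => /val_inj.
rewrite -[xi./2.+1]card_ord -(card_codom hI).
apply/subset_leq_card/fintype.subsetP => _ /codomP[k ->]; rewrite inE /h fP // gP //=.
rewrite -(size_map val) fP //; apply: leq_trans r1.
by rewrite size_filter (leq_trans (count_size _ _)).
Qed.

Lemma num_part_unbounded (K : nat) : exists xi, K < num_part xi.
Proof.
exists K.*2; rewrite -{1}(doubleK K).
apply: leq_trans (@num_part_le_half 2 _ isT) _.
by apply/subset_leq_card/fintype.subsetP => s; rewrite !inE => /andP[].
Qed.

Definition rho (K : nat) : nat := ex_minn (num_part_unbounded K).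

Definition eps (K : nat) : nat := `[< exists xi, num_part xi = K >].

Definition level_set (K r : nat) : set nat :=
  [set xi | num_part_le r xi = K]%classic.

(* [fset_set] is meaningful only on finite sets: this covers every [r] that   *)
(* occurs below.                                                              *)
Lemma level_set_finite (K r : nat) : 1 < r -> finite_set (level_set K r).
Proof.
move=> r1; apply: (@sub_finite_set _ _ `I_(K.*2)); last exact: finite_II.
move=> xi /= <-; rewrite -ltn_half_double; exact: num_part_le_half.
Qed.

Definition cK (K r : nat) : nat := #|` fset_set (level_set K r)|%fset.

(* [None] stands for minus infinity.                                          *)
Definition tau (K r : nat) : option nat :=
  if `[< exists xi, level_set K r xi >]
  then Some (\max_(xi <- fset_set (level_set K r)) xi)
  else None.

(* The value [0] given to the indices [r] with [tau K r = None] is neutral    *)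
(* for [maxn].                                                                *)
Definition n0 (K : nat) : nat :=
  maxn (2 * rho K - 1)
    (\max_(2 <= r < rho K) (if tau K r is Some t then r + t + 1 else 0)).

(* Main.v *)
(** The classes in {a,b}^n are indexed by the number k of letters a and the
    number m of scattered subwords ab, and their cardinalities are the
    coefficients G(k, n-k, m) of the Gaussian binomials.  Put r = min(k, n-k) and
    s = n - r.  For m <= s the coefficient G(r, s, m) is p_{<=r}(m), and
    symmetrically for m >= rs - s.  In the middle range s <= m <= rs - s the
    unimodality of Gaussian binomials is not needed: the two Pascal recurrences
    give G(3, s, m) >= s, hence G(r, s, m) >= s for all r >= 3.  Since
    tau_K(2) = 2K - 1, the hypothesis on n gives s > K (and s >= 2K if r = 2), so
    that no middle coefficient equals K.  Hence r >= 2 contributes twice the number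
    of m < s with p_{<=r}(m) = K, that is 2 c_K(r) if r < rho_K and 2 eps_K
    otherwise. *)
Require Import Defs.
From mathcomp Require Import all_boot all_order all_algebra.
From mathcomp Require Import finmap boolp classical_sets cardinality.
From mathcomp Require Import zify.

Set Implicit Arguments.
Unset Strict Implicit.
Unset Printing Implicit Defensive.

(** * Counting words of a given length *)

(** The predicate lives on [seq bool], so that the recursion on the first letter can pass from one
    length to another without casts. *)
Definition num_words (n : nat) (P : pred (seq bool)) : nat :=
  #|[pred w : n.-tuple bool | P w]|.

Lemma eq_num_words n (P Q : pred (seq bool)) :
  (forall s, size s = n -> P s = Q s) -> num_words n P = num_words n Q.
Proof. by move=> PQ; apply: eq_card => w; rewrite !inE PQ ?size_tuple. Qed.

Lemma num_words0 P : num_words 0 P = P [::].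
Proof.
case P0: (P [::]); last first.
  by apply: eq_card0 => w; rewrite inE tuple0 /= P0.
rewrite -[RHS](card1 ([tuple] : 0.-tuple bool)).
by apply: eq_card => w; rewrite !inE tuple0 /= P0 eqxx.
Qed.

Lemma num_words_nil n (P : pred (seq bool)) :
  (forall s, size s = n -> ~~ P s) -> num_words n P = 0.
Proof.
by move=> P0; apply: eq_card0 => w; rewrite inE; apply/negbTE/P0/size_tuple.
Qed.

Lemma num_wordsS n P : num_words n.+1 P =
  num_words n (fun s => P (letter_b :: s)) + num_words n (fun s => P (letter_a :: s)).
Proof.
rewrite /num_words -!sum1_card.
have bij : bijective (fun u : bool * n.-tuple bool => [tuple of u.1 :: u.2]).
  exists (fun w : n.+1.-tuple bool => (thead w, [tuple of behead w])).
    by move=> [x s]; congr pair; apply: val_inj.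
  by move=> w /=; rewrite -tuple_eta.
rewrite (reindex _ (onW_bij _ bij)) /=.
rewrite (eq_bigl (fun u : bool * n.-tuple bool => predT u.1 && P (u.1 :: u.2))) //.
rewrite -(pair_big_dep predT (fun x (s : n.-tuple bool) => P (x :: s)) (fun _ _ => 1)) /=.
by rewrite big_bool.
Qed.

Lemma num_words_involution n (f : seq bool -> seq bool) (P : pred (seq bool)) :
  involutive f -> (forall s, size (f s) = size s) ->
  num_words n (fun s => P (f s)) = num_words n P.
Proof.
move=> fK szf; rewrite /num_words -!sum1_card.
have szP (w : n.-tuple bool) : size (f w) == n by rewrite szf size_tuple.
rewrite [RHS](reindex (fun w : n.-tuple bool => Tuple (szP w))) //=.
by exists (fun w : n.-tuple bool => Tuple (szP w)) => w _; apply: val_inj => /=.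
Qed.

(** * Occurrences of ab as a scattered subword *)

Fixpoint nab (s : seq bool) : nat :=
  if s is x :: s' then (if x then 0 else count_mem letter_b s') + nab s' else 0.

Lemma num_masks_nil n (w : seq bool) : size w = n ->
  num_words n (fun m => mask m w == [::]) = 1.
Proof.
elim: n w => [|n IHn] [|x w] // => [_|[sw]]; first by rewrite num_words0.
rewrite num_wordsS /= num_words_nil ?IHn // => s _.
Qed.

Lemma num_masks1 n (w : seq bool) y : size w = n ->
  num_words n (fun m => mask m w == [:: y]) = count_mem y w.
Proof.
elim: n w => [|n IHn] [|x w] // => [_|[sw]]; first by rewrite num_words0.
rewrite num_wordsS /= IHn //; congr addn.
have [<-|xy] /= := eqVneq x y.
  rewrite -(num_masks_nil sw); apply: eq_num_words => s _.
  by rewrite eqseq_cons eqxx.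
by rewrite num_words_nil // => s _; rewrite eqseq_cons negb_and xy.
Qed.

Lemma word_binE n (w : n.-tuple bool) :
  word_bin w [:: letter_a; letter_b] = nab w.
Proof.
rewrite -[LHS]/(num_words n (fun m => mask m w == [:: letter_a; letter_b])).
have := size_tuple w; move: (tval w) => s {w}.
elim: n s => [|n IHn] [|x w] // => [_|[sw]]; first by rewrite num_words0.
rewrite num_wordsS /= IHn //; congr addn.
case: x => /=; first by rewrite num_words_nil // => s _; rewrite eqseq_cons.
rewrite -(num_masks1 _ sw); apply: eq_num_words => s _.
by rewrite eqseq_cons eqxx.
Qed.

Lemma nab_cat s t : nab (s ++ t) =
  nab s + count_mem letter_a s * count_mem letter_b t + nab t.
Proof. by elim: s => //= x s ->; rewrite count_cat; case: x => /=; lia. Qed.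

(** Each pair formed by a letter a and a letter b reads ab in exactly one of s and [rev s]. *)
Lemma nab_rev s : nab (rev s) + nab s = count_mem letter_a s * count_mem letter_b s.
Proof.
elim: s => //= x s IHs; rewrite rev_cons -cats1 nab_cat /= !count_rev.
by case: x => /=; lia.
Qed.

(** Reversal and exchange of letters both turn ab into ba, so together they preserve the occurrences
    of ab. On Young diagrams this is conjugation. *)
Lemma nab_rev_negb s : nab (rev (map negb s)) = nab s.
Proof.
elim: s => //= x s IHs; rewrite rev_cons -cats1 nab_cat /= !count_rev !count_map IHs.
have -> : count (preim negb (pred1 letter_a)) s = count_mem letter_b s.
  by apply: eq_count; case.
by case: x => /=; lia.
Qed.

Lemma count_letters s : count_mem letter_a s + count_mem letter_b s = size s.
Proof. by elim: s => //= x s <-; case: x => /=; lia. Qed.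

(** * Gaussian coefficients: symmetries and Pascal recurrences *)

(* The coefficient of q^m in the Gaussian binomial [k + l choose k]_q. *)
Definition gauss (k l m : nat) : nat :=
  num_words (k + l) (fun s => (count_mem letter_a s == k) && (nab s == m)).

Lemma gaussC k l m : gauss k l m = gauss l k m.
Proof.
rewrite /gauss -(@num_words_involution _ (fun s => rev (map negb s))).
- rewrite addnC; apply: eq_num_words => s sz.
  rewrite nab_rev_negb count_rev count_map.
  have -> : count (preim negb (pred1 letter_a)) s = count_mem letter_b s.
    by apply: eq_count; case.
  by have := count_letters s; rewrite sz => ?; congr (_ && _); lia.
- by move=> s; rewrite map_rev revK -map_comp map_id_in // => x _ /=; rewrite negbK.
- by move=> s; rewrite size_rev size_map.
Qed.

Lemma gauss_out k l m : k * l < m -> gauss k l m = 0.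
Proof.
move=> lem; apply: num_words_nil => s sz; apply/negP => /andP[/eqP ca /eqP nm].
have := nab_rev s; have := count_letters s; rewrite sz ca nm => cb.
have -> : count_mem letter_b s = l by lia.
by lia.
Qed.

Lemma gauss_compl k l m : m <= k * l -> gauss k l (k * l - m) = gauss k l m.
Proof.
move=> lem; rewrite /gauss -[RHS](num_words_involution _ _ (@revK _) (@size_rev _)).
apply: eq_num_words => s sz; rewrite count_rev.
have := nab_rev s; have := count_letters s; rewrite sz.
case: eqVneq => //= -> /addnI ->.
by move=> nn; lia.
Qed.

Lemma gauss0l l m : gauss 0 l m = (m == 0).
Proof.
elim: l => [|l IHl]; first by rewrite /gauss num_words0 /= eq_sym.
rewrite /gauss addnS num_wordsS /= -[X in X + _]/(gauss 0 l m) IHl.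
by rewrite num_words_nil ?addn0.
Qed.

(** Split on the first letter: a leading b adds no occurrence of ab, a leading a adds one for each
    of the l + 1 letters b. The test keeps the truncated subtraction exact. *)
Lemma gaussSS k l m : gauss k.+1 l.+1 m =
  gauss k.+1 l m + (if l < m then gauss k l.+1 (m - l.+1) else 0).
Proof.
rewrite /gauss -addSnnS addSn num_wordsS /= addSnnS; congr addn.
case: ifP => lm.
  apply: eq_num_words => s sz; have := count_letters s; rewrite sz add1n eqSS.
  by case: eqVneq => //= -> /addnI ->; apply/eqP/eqP; lia.
apply: num_words_nil => s sz; have := count_letters s; rewrite sz add1n eqSS.
by case: eqVneq => //= -> /addnI ->; apply/eqP; lia.
Qed.

Lemma gaussSS' k l m : gauss k.+1 l.+1 m =
  gauss k l.+1 m + (if k < m then gauss k.+1 l (m - k.+1) else 0).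
Proof. by rewrite gaussC gaussSS (gaussC l.+1) (gaussC l). Qed.

Lemma gauss1l l m : gauss 1 l m = (m <= l).
Proof.
elim: l => [|l IHl]; first by rewrite gaussC gauss0l leqn0.
by rewrite gaussSS IHl; case: ifP => lm; rewrite ?gauss0l; lia.
Qed.

(** * Lower bounds for the middle coefficients *)

Lemma gauss2_gt0 l m : m <= l.*2 -> 0 < gauss 2 l m.
Proof.
elim: l m => [|l IHl] m lem; first by rewrite gaussC gauss0l; lia.
rewrite gaussSS' gauss1l; have [//|lm] := leqP m l.+1.
by rewrite ifT; [apply: ltn_addl; apply: IHl; lia|lia].
Qed.

(* The recurrence on m - 3 misses only m = l and m = l + 1, which the symmetry
   m <-> 3l - m brings back into its range. *)
Lemma gauss3_ge l m : l <= m <= l.*2 -> l <= gauss 3 l m.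
Proof.
elim: l m => [|l IHl] m lem //.
wlog lm : m lem / l.+2 < m \/ l < 2.
  move=> H; have [lm|ml] := ltnP l.+2 m; first by apply: H => //; left.
  have [l2|l2] := ltnP l 2; first by apply: H => //; right.
  rewrite -gauss_compl; last by lia.
  by apply: H; lia.
have [lm'|ml] := ltnP l.+2 m.
  rewrite gaussSS' ifT; last by lia.
  have := @gauss2_gt0 l.+1 m; have := IHl (m - 3); lia.
have [l0|l1] : l = 0 \/ l = 1 by lia.
  by rewrite l0 gaussC gauss1l; lia.
rewrite l1 gaussC gaussSS' gauss1l ifT; last by lia.
by have := @gauss2_gt0 2 (m - 2); lia.
Qed.

(** Induction on r from [gauss3_ge]. For r >= 3 the interval [l, rl] needed at r + 1 is the union of
    [l, (r-1)l] and its translate by l; [gaussSS'] serves the former, [gaussSS] the rest. *)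
Lemma gauss_ge r l m : 2 < r -> l <= m <= r.-1 * l -> l <= gauss r l m.
Proof.
case: l => // l.
elim: r m => // r IHr m; rewrite ltnS leq_eqVlt => /orP[/eqP <-|r2] lem.
  by apply: gauss3_ge; lia.
have [lm|lm] := leqP m (r.-1 * l.+1).
  by rewrite gaussSS'; apply/ltn_addr/IHr => //; lia.
have {}lm : l < m - l.+1.
  by apply: leq_trans (leq_sub2r _ lm); rewrite subSn //; nia.
rewrite gaussSS ifT; last by lia.
by apply/ltn_addl/IHr => //; nia.
Qed.

(** * Lattice paths and partitions in a box *)

(* The Young diagram above the lattice path s: one part, the number of letters b
   to its right, for each letter a; null parts are dropped. *)
Fixpoint word_part (s : seq bool) : seq nat :=
  if s is x :: s' then
    if x || (count_mem letter_b s' == 0) then word_part s'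
    else count_mem letter_b s' :: word_part s'
  else [::].

Lemma word_part_le s : all (fun i => i <= count_mem letter_b s) (word_part s).
Proof.
elim: s => //= x s IHs; case: ifP => _ /=; last apply/andP; try split.
- by apply: sub_all IHs => i /= /leq_trans; apply; apply: leq_addl.
- exact: leq_addl.
- by apply: sub_all IHs => i /= /leq_trans; apply; apply: leq_addl.
Qed.

Lemma size_word_part s : size (word_part s) <= count_mem letter_a s.
Proof. by elim: s => //= x s IHs; case: x => /=; [|case: ifP => _ /=]; lia. Qed.

Lemma word_part_partition s : is_partition (nab s) (word_part s).
Proof.
elim: s => //= x s /and3P[so z0 /eqP su].
case: x => /=; first by apply/and3P; split; rewrite ?su.
case: eqVneq => [->|cb] /=; first by apply/and3P; split; rewrite ?su.
apply/and3P; split => //=; last by rewrite su.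
  by rewrite path_min_sorted // word_part_le.
by rewrite inE negb_or eq_sym cb.
Qed.

Lemma word_part_inj s t : count_mem letter_a s = count_mem letter_a t ->
  count_mem letter_b s = count_mem letter_b t -> word_part s = word_part t -> s = t.
Proof.
wlog le_st : s t / size s <= size t => [H a b p|].
  by have [/H|/ltnW/H] := leqP (size s) (size t); [exact|move=> ->].
(* The parts determine the first letter: a leading a produces a part equal to the total number of
   letters b, too large for a word of the same content that starts with b. *)
have head_gt u v : count_mem letter_b u = (count_mem letter_b v).+1 ->
    word_part (letter_a :: u) != word_part (letter_b :: v).
  move=> cu; rewrite /= cu /=; apply/eqP => wv.
  by have := word_part_le v; rewrite -wv /= ltnn.
elim: s t le_st => [|x s IHs] [|y t] //= le_st; try by case: y => /=; lia.
case: x y => [] [] /=.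
- by move=> /addnI sa /addnI sb /IHs ->.
- rewrite add1n add0n => _ /esym sb H; have /negP[] := head_gt t s sb.
  by apply/eqP; rewrite /= H.
- rewrite add1n add0n => _ sb H; have /negP[] := head_gt s t sb.
  by apply/eqP; rewrite /= H.
- move=> /addnI sa /addnI sb; rewrite sb.
  by case: ifP => _; last case; move/IHs => ->.
Qed.

(** The word is built from its first letter: a if the largest part equals l, and this part is
    removed; b otherwise, and l drops by one. At l = 0 only letters a remain. *)
Lemma word_part_surj k l p : sorted geq p -> 0 \notin p -> size p <= k ->
  all (fun i => i <= l) p -> exists s, [/\ count_mem letter_a s = k,
    count_mem letter_b s = l & word_part s = p].
Proof.
elim: l k p => [|l IHl] k p so p0 szp lep.
  exists (nseq k letter_a); rewrite !count_nseq mul0n mul1n; split=> //.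
  case: p p0 lep {so szp} => [_ _|x p]; last by rewrite inE /=; case: x.
  by elim: k => //= k ->; rewrite count_nseq.
elim: p k so p0 szp lep => [|x p IHp] k so p0 szp lep.
  have [//|//|//|//|s [sa sb sp]] := IHl k [::].
  by exists (letter_b :: s); split => //=; rewrite ?sb ?sa.
move: p0 lep => /=; rewrite inE negb_or => /andP[x0 p0] /andP[].
rewrite leq_eqVlt => /orP[/eqP xl lep|xl _].
  case: k szp => // k szp; have [|s [sa sb sp]] := IHp k _ p0 szp lep.
  - exact: (path_sorted so).
  - by exists (letter_a :: s); split => //=; rewrite ?sa ?sb ?sp ?xl.
have [|//||s [sa sb sp]] := IHl k (x :: p) so; first by rewrite inE negb_or x0.
  rewrite /= -ltnS xl /=; move: so => /= /(order_path_min (rev_trans leq_trans)).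
  by apply: sub_all => i /= /leq_trans; apply.
by exists (letter_b :: s); split => //=; rewrite ?sb ?sa.
Qed.

(** Parts of a partition of m <= l never exceed l, so of the two sides of the box only the bound r
    on the number of parts is felt. *)
Lemma gauss_num_part_le r l m : m <= l -> gauss r l m = num_part_le r m.
Proof.
move=> ml; rewrite /gauss /num_words /num_part_le.
set A := [pred w | _]; set B := [pred s | _].
(* Both sets are embedded in [seq nat], where their images are the same duplicate-free list up to
   order. *)
rewrite !cardE -(size_map (fun w : (r + l).-tuple bool => word_part w)).
rewrite -[RHS](size_map (fun s : m.-bseq 'I_m.+1 => map val s)).
apply/perm_size/uniq_perm.
- rewrite map_inj_in_uniq ?enum_uniq // => u v; rewrite !mem_enum !inE.
  move=> /andP[/eqP ua _] /andP[/eqP va _] uv; apply: val_inj.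
  apply: word_part_inj => //; first by rewrite ua va.
  apply: (@addnI (count_mem letter_a u)).
  by rewrite {2}(etrans ua (esym va)) !count_letters !size_tuple.
- rewrite map_inj_uniq ?enum_uniq // => u v uv.
  by apply/val_inj/(inj_map val_inj).
move=> p; apply/mapP/mapP => [[w]|[t]]; rewrite mem_enum inE.
  move=> /andP[/eqP wa /eqP wm] ->; have := size_word_part w.
  rewrite {}wa => szw; have := word_part_partition w; rewrite wm => wp.
  have [t tw] := is_partition_bseq wp; exists t => //.
  by rewrite mem_enum inE tw wp -(size_map val) tw.
move=> /andP[tp szt ->]; case/and3P: (tp) => so p0 /eqP sm.
have [||s [sa sb sp]] := @word_part_surj r l _ so p0; first by rewrite size_map.
  apply/allP => i /perm_to_rem/perm_sumn; rewrite sm /= => mE.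
  by apply: leq_trans ml; rewrite mE leq_addr.
have szs : size s == r + l by rewrite -count_letters sa sb.
exists (Tuple szs) => //; rewrite mem_enum inE /= sa eqxx.
by have /and3P[_ _] := word_part_partition s; rewrite sp sm eq_sym.
Qed.

(** * Growth of the partition numbers *)

(** The Pascal recurrence in a box of width m + 1, wide enough for every coefficient involved to be
    a partition number. *)
Lemma num_part_le_rec r m : num_part_le r.+1 m =
  num_part_le r m + (if r < m then num_part_le r.+1 (m - r.+1) else 0).
Proof.
rewrite -(@gauss_num_part_le r.+1 m.+1) // gaussSS' gauss_num_part_le //.
by case: ifP => // _; rewrite gauss_num_part_le ?leq_subr.
Qed.

Lemma num_part_le0 r : num_part_le r 0 = 1.
Proof. by rewrite -(@gauss_num_part_le r 0) // gaussC gauss0l. Qed.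

Lemma num_part_le1 m : num_part_le 1 m = 1.
Proof. by rewrite -(@gauss_num_part_le 1 m) // gauss1l leqnn. Qed.

Lemma num_part_le2 m : num_part_le 2 m = m./2.+1.
Proof.
elim/ltn_ind: m => m IHm; rewrite num_part_le_rec num_part_le1.
by case: ifP => m1; [rewrite IHm|]; lia.
Qed.

Lemma num_part_leS r m : 0 < r -> num_part_le r m <= num_part_le r m.+1.
Proof.
case: r => // r _; elim: r m => [|r IHr] m; first by rewrite !num_part_le1.
elim/ltn_ind: m => m IHm.
rewrite (num_part_le_rec _ m) (num_part_le_rec _ m.+1) leq_add //.
case: ifP => // rm; rewrite ifT; last by lia.
by rewrite subSn //; apply: IHm; lia.
Qed.

Lemma num_part_le_mono r : 0 < r -> {homo num_part_le r : m n / m <= n}.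
Proof.
by move=> r0; apply: homo_leq leq_trans _ => // m; apply: num_part_leS.
Qed.

Lemma num_partE r m : m <= r -> num_part m = num_part_le r m.
Proof.
move=> mr; apply: eq_card => s; rewrite !inE; case: is_partition => //=.
by rewrite (leq_trans (size_bseq s)).
Qed.

(** Besides the partitions into at most m parts, m + 1 has the partition into ones. Strictness fails
    at 0, as p(0) = p(1) = 1. *)
Lemma num_partS m : 0 < m -> num_part m < num_part m.+1.
Proof.
move=> m0; rewrite (@num_partE m.+1 m.+1) // num_part_le_rec ltnSn subnn.
by rewrite num_part_le0 addn1 ltnS (@num_partE m) //; apply: num_part_leS.
Qed.

Lemma num_part0 : num_part 0 = 1.
Proof. by rewrite (@num_partE 0) // num_part_le0. Qed.

Lemma num_part1 : num_part 1 = 1.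
Proof. by rewrite (@num_partE 1) // num_part_le1. Qed.

Lemma num_part_ltn i j : 0 < i -> i < j -> num_part i < num_part j.
Proof.
move=> i0; elim: j => // j IHj; rewrite ltnS leq_eqVlt => /orP[/eqP <-|ij].
  exact: num_partS.
by apply: ltn_trans (IHj ij) (num_partS _); lia.
Qed.

Lemma num_part_mono : {homo num_part : i j / i <= j}.
Proof.
move=> [|i] j; last first.
  by rewrite leq_eqVlt => /orP[/eqP <- //|/num_part_ltn/ltnW]; apply.
case: j => // -[|j] _; first by rewrite num_part0 num_part1.
by rewrite num_part0 -num_part1; apply/ltnW/num_part_ltn.
Qed.

Lemma rho_gt K : K < num_part (rho K).
Proof. by rewrite /rho; case: ex_minnP. Qed.

Lemma rho_gt2 K : 1 < K -> 2 < rho K.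
Proof.
move=> K1; rewrite ltnNge; apply/negP => /num_part_mono/(leq_trans (rho_gt K)).
by rewrite (@num_partE 2) // num_part_le2 /=; lia.
Qed.

(** * The numbers eps and c as sums of indicators *)

Lemma sum_nat_eq1 (P : pred nat) N i : i < N -> P i -> (forall j, P j -> j = i) ->
  \sum_(0 <= m < N) P m = 1.
Proof.
move=> iN Pi Pu; rewrite (bigD1_seq i) ?mem_index_iota ?iota_uniq //= Pi.
rewrite big1_seq // => j /andP[ji _]; apply/eqP; rewrite eqb0.
by apply: contra ji => /Pu/eqP.
Qed.

(** Since p increases strictly from 1 on, a value K > 1 is taken at most once, and before
    [rho K]. *)
Lemma eps_sum K N : 1 < K -> rho K <= N ->
  \sum_(0 <= m < N) (num_part m == K) = eps K.
Proof.
move=> K1 KN; rewrite /eps; case: asboolP => [[i /eqP pi]|np]; last first.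
  by rewrite big1 // => m _; apply/eqP; rewrite eqb0; apply/eqP => pm; case: np; exists m.
have ne0 j : num_part j == K -> 0 < j.
  by case: j => // /eqP; rewrite num_part0; lia.
apply: (@sum_nat_eq1 (fun m => num_part m == K) N i) => //.
  apply: leq_trans KN; rewrite ltnNge; apply/negP => /num_part_mono.
  by rewrite (eqP pi) leqNgt rho_gt.
move=> j pj; have := ne0 _ pi; have := ne0 _ pj; case: (ltngtP i j) => // ij j0 i0.
  by have := num_part_ltn i0 ij; rewrite (eqP pi) (eqP pj) ltnn.
by have := num_part_ltn j0 ij; rewrite (eqP pi) (eqP pj) ltnn.
Qed.

Lemma cK_sum K r N : 1 < r -> (forall m, num_part_le r m = K -> m < N) ->
  \sum_(0 <= m < N) (num_part_le r m == K) = cK K r.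
Proof.
move=> r1 HN; transitivity (size [seq m <- index_iota 0 N | num_part_le r m == K]).
  rewrite size_filter -sum1_count [RHS]big_mkcond.
  by apply: eq_bigr => m _; case: eqP.
apply/perm_size/uniq_perm; rewrite ?filter_uniq ?iota_uniq ?fset_uniq // => m.
rewrite in_fset_set ?mem_filter ?mem_index_iota; last exact: level_set_finite.
apply/idP/idP => [/andP[/eqP pm _]|]; first by rewrite inE.
by rewrite inE => /= pm; rewrite pm eqxx (HN _ pm).
Qed.

(** * Classes of cardinality K with a given number of letters a *)

(** The multiplicity of K among the coefficients of the Gaussian binomial [k + l choose k]_q. *)
Definition gauss_mult (K k l : nat) : nat :=
  \sum_(0 <= m < (k * l).+1) (gauss k l m == K).

Lemma gauss_multC K k l : gauss_mult K k l = gauss_mult K l k.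
Proof. by rewrite /gauss_mult mulnC; apply: eq_bigr => m _; rewrite gaussC. Qed.

Lemma nab_le s : nab s <= count_mem letter_a s * count_mem letter_b s.
Proof. by rewrite -nab_rev leq_addl. Qed.

Lemma num_classesE K n : 0 < K ->
  num_classes K n = \sum_(0 <= k < n.+1) gauss_mult K k (n - k).
Proof.
move=> K0.
(* The uniform bound n * n on m makes the index set a rectangle. Indices with empty fibre are
   harmless because K > 0. *)
pose S (u : 'I_n.+1 * 'I_(n * n).+1) : {set n.-tuple bool} :=
  [set w : n.-tuple bool | (count_mem letter_a w == u.1) && (nab w == u.2)]%SET.
have cardS u : #|S u| = gauss u.1 (n - u.1) u.2.
  by rewrite cardsE /gauss subnKC // -ltnS.
pose Q := [set u | #|S u| == K]%SET.
have injS : {in Q &, injective S}.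
  move=> u v; rewrite !inE => /eqP Su _ Suv.
  have [w wu] : exists w, w \in S u by apply/set0Pn; rewrite -card_gt0 Su.
  have := wu; rewrite Suv; move: wu; rewrite !inE.
  case: u v {Su Suv} => [u1 u2] [v1 v2] /= /andP[/eqP a1 /eqP a2] /andP[/eqP b1 /eqP b2].
  by congr pair; apply: val_inj => /=; rewrite -?a1 -?a2.
transitivity #|Q|.
  rewrite -(card_in_imset injS); apply: eq_card => C; rewrite inE.
  apply/andP/imsetP => [[/imsetP[w _ CE] /eqP CK]|[u uQ ->]]; last first.
    move: uQ; rewrite inE => Su; split => //.
    have [w wu] : exists w, w \in S u by apply/set0Pn; rewrite -card_gt0 (eqP Su).
    apply/imsetP; exists w => //; apply/setP => y.
    move: wu; rewrite !inE /sim2 !word_binE => /andP[/eqP -> /eqP ->].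
    by rewrite /= !(eq_sym (nat_of_ord _)).
  have ca : count_mem letter_a w < n.+1.
    by rewrite ltnS -[X in _ <= X](size_tuple w) count_size.
  have cm : nab w < (n * n).+1.
    rewrite ltnS (leq_trans (nab_le w)) // -[in X in _ <= X](size_tuple w).
    by rewrite leq_mul ?count_size.
  have CS : C = S (Ordinal ca, Ordinal cm).
    rewrite CE; apply/setP => y; rewrite !inE /sim2 !word_binE /=.
    by rewrite eq_sym [X in _ && X]eq_sym.
  by exists (Ordinal ca, Ordinal cm); rewrite // inE -CS CK.
rewrite -sum1_card big_mkcond /=.
pose F (i : 'I_n.+1) (j : 'I_(n * n).+1) := nat_of_bool (gauss i (n - i) j == K).
rewrite (eq_bigr (fun u => F u.1 u.2)) => [|u _]; last first.
  by rewrite inE cardS /F; case: eqP.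
rewrite -(pair_bigA _ F) /=.
rewrite big_mkord; apply: eq_bigr => k _; rewrite /gauss_mult.
rewrite -(big_mkord predT (fun m => nat_of_bool (gauss k (n - k) m == K))).
(* Beyond the degree k(n - k) the coefficients vanish, hence differ from K. *)
rewrite (big_cat_nat (n := (k * (n - k)).+1)) //=; last first.
  by rewrite ltnS leq_mul ?leq_subr // -ltnS.
rewrite [X in _ + X]big1_seq ?addn0 // => m /andP[_].
rewrite mem_index_iota => /andP[mk _]; by rewrite gauss_out // ltn_eqF.
Qed.

Lemma gauss_mult_small K k l : k < 2 -> 1 < K -> gauss_mult K k l = 0.
Proof.
move=> k2 K1; rewrite /gauss_mult big1 // => m _; apply/eqP; rewrite eqb0.
case: k k2 => [|[|//]] _; rewrite ?gauss0l ?gauss1l ltn_eqF //;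
  apply: leq_ltn_trans K1; exact: leq_b1.
Qed.

Lemma gauss_mult_ge2 K r s : 1 < r -> r <= s -> K < s -> (r = 2 -> K.*2 <= s) ->
  gauss_mult K r s = 2 * \sum_(0 <= m < s) (num_part_le r m == K).
Proof.
move=> r1 rs Ks r2; rewrite /gauss_mult.
have srs : s <= (r * s - s).+1 by nia.
rewrite (big_cat_nat (n := (r * s - s).+1)) //=; last by nia.
rewrite (big_cat_nat (n := s)) //=.
have -> : \sum_(s <= m < (r * s - s).+1) (gauss r s m == K) = 0.
  rewrite big1_seq // => m /andP[_]; rewrite mem_index_iota => msr.
  apply/eqP; rewrite eqb0 gtn_eqF //.
  (* For r = 2 the middle range is the single index m = s, where the coefficient is the integer part
     of s/2, plus 1, and s >= 2K. *)
  have [r2'|r2'] : r = 2 \/ 2 < r by lia.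
    have -> : m = s by nia.
    rewrite r2' gauss_num_part_le // num_part_le2; lia.
  by apply: (leq_trans Ks); apply: gauss_ge => //; nia.
rewrite addn0 mul2n -addnn; congr addn.
  apply: eq_big_nat => m /andP[_ ms]; rewrite gauss_num_part_le //; exact: ltnW.
(* The reflection of m to rs - m carries the top range onto m < s. *)
rewrite big_nat_rev -{1}[(r * s - s).+1]add0n big_addn.
have -> : (r * s).+1 - (r * s - s).+1 = s by nia.
apply: eq_big_nat => m /andP[_ ms]; rewrite -(@gauss_num_part_le r s) ?(ltnW ms) //.
rewrite -(@gauss_compl r s m); last by nia.
by congr (nat_of_bool (gauss _ _ _ == _)); nia.
Qed.

(** * Summation over the number of letters a *)

(** This places every solution m of p_{<=r}(m) = K with r < rho_K in the range m < n - r where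
    [gauss] counts partitions. *)
Lemma tau_bound K r n m : n0 K <= n -> 2 <= r < rho K -> num_part_le r m = K ->
  r + m < n.
Proof.
move=> Kn rK pm; apply: leq_trans Kn; rewrite /n0 leq_max; apply/orP; right.
rewrite (bigD1_seq r) ?mem_index_iota ?iota_uniq //= leq_max; apply/orP; left.
rewrite /tau asboolT; last by exists m.
rewrite addn1 ltnS leq_add2l; apply: (leq_bigmax_seq (F := id)) => //.
by rewrite in_fset_set ?inE //; apply: level_set_finite; case/andP: rK.
Qed.

Lemma num_classes_sum K n : 1 < K -> n0 K <= n ->
  num_classes K n = 2 * eps K * (n.+1 - (rho K).*2) + 4 * \sum_(2 <= r < rho K) cK K r.
Proof.
move=> K1 Kn; set R := rho K.
have R2 : 2 < R := rho_gt2 K1.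
(* The index r = 2 is admissible because rho_K > 2, and p_{<=2}(2K - 1) = K. *)
have n2 : K.*2.+1 < n.
  have := @tau_bound K 2 n K.*2.-1 Kn.
  by rewrite num_part_le2 => /(_ R2); lia.
have nR : R.*2 <= n.+1.
  by move: Kn; rewrite /n0 geq_max => /andP[+ _]; rewrite -/R; lia.
have half k : 1 < k -> k <= n - k ->
    gauss_mult K k (n - k) = 2 * \sum_(0 <= m < n - k) (num_part_le k m == K).
  by move=> k1 kn; apply: gauss_mult_ge2; lia.
have low : \sum_(0 <= k < R) gauss_mult K k (n - k) = 2 * \sum_(2 <= r < R) cK K r.
  rewrite (big_cat_nat (n := 2)) //=; last exact: ltnW.
  rewrite big1_seq ?add0n; last first.
    by move=> k; rewrite mem_index_iota /= => k2; apply: gauss_mult_small.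
  rewrite big_distrr; apply: eq_big_nat => k /andP[k1 kR] /=.
  rewrite half //; last by lia.
  rewrite cK_sum // => m /(tau_bound Kn); rewrite k1 kR => /(_ isT); lia.
have mid : forall k, R <= k -> k <= n - k -> gauss_mult K k (n - k) = 2 * eps K.
  move=> k Rk kn; rewrite half //; last by lia.
  rewrite -(@eps_sum K (n - k)) //; last by lia.
  congr muln; apply: eq_big_nat => m _.
  have [mk|km] := leqP m k; first by rewrite (num_partE mk).
  (* For m > k >= rho_K both p(m) and p_{<=k}(m) exceed K, the latter being at least p_{<=k}(k) =
     p(k). *)
  rewrite !gtn_eqF //; first by apply: leq_trans (rho_gt K) (num_part_mono _); lia.
  rewrite (leq_trans (rho_gt K)) // (@num_partE k) //.
  by apply: num_part_le_mono; lia.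
rewrite num_classesE; last exact: ltnW.
(* The ranges k < R and k > n - R are exchanged by the symmetry of k and n - k; between them lie n +
   1 - 2R indices, possibly none. *)
rewrite (big_cat_nat (n := R)) //=; last by lia.
rewrite (big_cat_nat (n := n.+1 - R) (m := R)) //=; [|by lia|by lia].
have -> : \sum_(n.+1 - R <= k < n.+1) gauss_mult K k (n - k) =
    \sum_(0 <= k < R) gauss_mult K k (n - k).
  rewrite big_nat_rev -{1}[n.+1 - R]add0n big_addn subKn; last by lia.
  apply: eq_big_nat => k kR; rewrite gauss_multC; congr gauss_mult; lia.
have -> : \sum_(R <= k < n.+1 - R) gauss_mult K k (n - k) =
    \sum_(R <= k < n.+1 - R) 2 * eps K.
  apply: eq_big_nat => k kR; have [kn|nk] := leqP k (n - k); first by apply: mid; lia.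
  have kn : k <= n by lia.
  rewrite gauss_multC -[X in gauss_mult _ _ X](subKn kn).
  by apply: mid; rewrite ?subKn //; lia.
rewrite low sum_nat_const_nat; have -> : n.+1 - R - R = n.+1 - R.*2 by lia.
by rewrite [X in _ = X + _]mulnC; lia.
Qed.

Local Open Scope ring_scope.

Theorem theorem4 (K n : nat) (hK : (2 <= K)%N) (hn : (n0 K <= n)%N) :
  (num_classes K n)%:Z =
    2 * (eps K)%:Z * (n%:Z - 2 * (rho K)%:Z + 1)
    + 4 * \sum_(2 <= r < rho K) (cK K r)%:Z.
Proof.
have nR : ((rho K).*2 <= n.+1)%N.
  by move: hn; rewrite /n0 geq_max => /andP[+ _]; lia.
have -> : \sum_(2 <= r < rho K) (cK K r)%:Z =
    (\sum_(2 <= r < rho K) cK K r)%N%:Z.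
  by rewrite -natz GRing.natr_sum; apply: eq_bigr => r _; rewrite natz.
(* By [nR] the truncated subtraction is exact. *)
have -> : n%:Z - 2 * (rho K)%:Z + 1 = (n.+1 - (rho K).*2)%N%:Z by lia.
by rewrite num_classes_sum // PoszD !PoszM.
Qed.
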